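(* Let $n,m\ge 2$ and let $\varphi$ be an endomorphism of $F_n\times F_m$. Then, up to interchanging the order of the two factors, $\varphi$ has one of the following forms (where $i$ ranges over $\{1,\dots,n\}$ and $j$ over $\{1,\dots,m\}$): (I) $(a_i,1)\mapsto(u^{p_i},v^{q_i})$, $(1,b_j)\mapsto(u^{r_j},v^{s_j})$ for some $1\ne u\in F_n$, $1\ne v\in F_m$ and integers $p_i,q_i,r_j,s_j$ such that none of the sets $\{p_i\}_i,\{q_i\}_i,\{r_j\}_j,\{s_j\}_j$ equals $\{0\}$; (II) $(a_i,1)\mapsto(1,v^{q_i})$, $(1,b_j)\mapsto(z_j,v^{s_j})$ for some $1\ne v\in F_m$, $z_j\in F_n$ and integers $q_i,s_j$ such that $\{q_i\}_i\ne\{0\}$, $\{s_j\}_j\neq\{0\}$ and $\{z_j\}_j\ne\{1\}$; (III) $(a_i,1)\mapsto(u^{p_i},1)$, $(1,b_j)\mapsto(u^{r_j},w_j)$ for some $1\ne u\in F_n$, $w_j\in F_m$ and integers $p_i,r_j$ such that $\{p_i\}_i\ne\{0\}$, $\{r_j\}_j\ne\{0\}$ and $\{w_j\}_j\ne\{1\}$; (IV) $(a_i,1)\mapsto(1,1)$, $(1,b_j)\mapsto(z_j,w_j)$ for some $(z_j,w_j)\in F_n\times F_m$ such that $\{z_j\}_j\ne\{1\}$ and $\{w_j\}_j\ne\{1\}$; (V) $(a_i,1)\mapsto(1,v^{q_i})$, $(1,b_j)\mapsto(1,v^{s_j})$ for some $1\ne v\in F_m$ and integers $q_i,s_j$ such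 that $\{q_i\}_i\ne\{0\}$ and $\{s_j\}_j\ne\{0\}$; (VI) $(a_i,1)\mapsto(x_i,1)$, $(1,b_j)\mapsto(1,w_j)$ for some $x_i\in F_n$, $w_j\in F_m$; (VII) $(a_i,1)\mapsto(1,y_i)$, $(1,b_j)\mapsto(z_j,1)$ for some $y_i\in F_m$, $z_j\in F_n$.
   Context: $F_n$ is the free group with basis $a_1,\dots,a_n$ and $F_m$ is the free group with basis $b_1,\dots,b_m$. ''Up to interchanging the order of the factors'' means: either $\varphi$ itself has one of the forms, or the endomorphism $\sigma^{-1}\varphi\sigma$ of $F_m\times F_n$ (maps acting on the right and composed left to right, $\sigma:F_n\times F_m\to F_m\times F_n$, $(x,y)\mapsto(y,x)$) has one of the forms with the roles of $n$ and $m$ (and of the bases) exchanged. *)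

(* Defs.v *)
From HB Require Import structures.
From mathcomp Require Import all_boot ssralg ssrint.

Set Implicit Arguments.
Unset Strict Implicit.
Unset Printing Implicit Defensive.

Local Open Scope group_scope.

(* The free group on a choiceType T is the type of freely reduced words; the  *)
(* letter (t, false) stands for the generator t and (t, true) for t^-1.       *)

Section FreeGroup.
Variable T : choiceType.

Implicit Types (x y : T * bool) (s w : seq (T * bool)).

Definition linv x : T * bool := (x.1, ~~ x.2).

Definition reduced : pred (seq (T * bool)) := sorted (fun x y => y != linv x).

(* [push x s] is the reduced form of x :: s when s is reduced, so that *)
(* [act w s] is the reduced form of w ++ s when s is reduced.          *)
Definition push x s :=
  if s is y :: s' then if y == linv x then s' else x :: s else [:: x].

Definition act w s := foldr push s w.

Definition winv s := rev (map linv s).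

Lemma linvK : involutive linv.
Proof. by case=> t b; rewrite /linv /= negbK. Qed.

Lemma reduced_push x s : reduced s -> reduced (push x s).
Proof.
case: s => [|y s] //= rs; case: ifPn => [_|yx]; first exact: path_sorted rs.
by rewrite /= yx.
Qed.

Lemma reduced_act w s : reduced s -> reduced (act w s).
Proof. by move=> rs; elim: w => //= x w; apply: reduced_push. Qed.

Lemma pushK x s : reduced s -> push x (push (linv x) s) = s.
Proof.
case: s => [|y s] /=; first by rewrite eqxx.
case: eqP => [->|_] rs; last by rewrite /= eqxx.
rewrite linvK in rs *.
by case: s rs => [|z s] //= /andP[/negPf->].
Qed.

Lemma act_nil s : reduced s -> act s [::] = s.
Proof.
elim: s => //= x s IHs rs; rewrite IHs; last exact: path_sorted rs.
by case: s rs {IHs} => [|y s] //= /andP[/negPf->].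
Qed.

Lemma act_push x w s : reduced s -> act (push x w) s = push x (act w s).
Proof.
move=> rs; case: w => [|y w] //=; case: eqP => [->|//].
by rewrite pushK // reduced_act.
Qed.

Lemma act_act v w s : reduced s -> act (act v w) s = act v (act w s).
Proof. by move=> rs; elim: v => //= x v IHv; rewrite act_push // IHv. Qed.

Lemma act_winv w s : reduced s -> act (winv w) (act w s) = s.
Proof.
move=> rs; elim: w => //= x w IHw.
rewrite /winv /= rev_cons -cats1 /act foldr_cat /=.
by have := pushK (linv x) (reduced_act w rs); rewrite linvK => ->.
Qed.

Lemma winvK : involutive winv.
Proof.
move=> s; rewrite /winv map_rev revK -map_comp.
by rewrite map_id_in // => x _ /=; rewrite linvK.
Qed.

Lemma reduced_winv s : reduced s -> reduced (winv s).
Proof.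
rewrite /reduced /winv rev_sorted sorted_map; apply: sub_sorted => x y /=.
by apply: contra => /eqP xy; rewrite -[x]linvK xy !linvK.
Qed.

Definition free_group := {s : seq (T * bool) | reduced s}.

HB.instance Definition _ := Choice.on free_group.

Implicit Types g h k : free_group.

Definition fg_one : free_group := exist _ [::] isT.
Definition fg_mul g h : free_group :=
  exist _ (act (val g) (val h)) (reduced_act (val g) (valP h)).
Definition fg_inv g : free_group :=
  exist _ (winv (val g)) (reduced_winv (valP g)).

Lemma fg_mulA : associative fg_mul.
Proof. by move=> g h k; apply: val_inj; rewrite /= act_act //; apply: valP. Qed.

Lemma fg_mul1 : left_id fg_one fg_mul.
Proof. by move=> g; apply: val_inj. Qed.

Lemma fg_mulr1 : right_id fg_one fg_mul.
Proof. by move=> g; apply: val_inj; rewrite /= act_nil //; apply: valP. Qed.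

Lemma fg_mulV : left_inverse fg_one fg_inv fg_mul.
Proof.
move=> g; apply: val_inj => /=.
by rewrite -{2}(act_nil (valP g)) act_winv.
Qed.

Lemma fg_mulrV : right_inverse fg_one fg_inv fg_mul.
Proof.
move=> g; rewrite -{1}[g](_ : fg_inv (fg_inv g) = g) ?fg_mulV //.
by apply: val_inj; apply: winvK.
Qed.

HB.instance Definition _ :=
  isGroup.Build free_group fg_mulA fg_mul1 fg_mulr1 fg_mulV fg_mulrV.

Definition fg_gen (t : T) : free_group := exist _ [:: (t, false)] isT.

(* Universal property: [fg_gen] is a basis of [free_group]. *)
Section Universal.
Variables (G : groupType) (f : T -> G).

Definition letter_val x : G := if x.2 then (f x.1)^-1 else f x.1.
Definition word_val w : G := \prod_(x <- w) letter_val x.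

Lemma word_val_push x s : word_val (push x s) = letter_val x * word_val s.
Proof.
case: s => [|y s]; rewrite /word_val /= ?big_seq1 ?big_nil ?mulg1 //.
case: eqP => [->|_]; rewrite !big_cons // mulgA.
by case: x => t [] /=; rewrite /letter_val /= ?mulVg ?mulgV mul1g.
Qed.

Definition fg_lift (g : free_group) : G := word_val (val g).

Fact fg_lift_is_multiplicative : {morph fg_lift : g h / g * h}.
Proof.
move=> g h; rewrite /fg_lift /=; elim: (val g) => [|x w IHw] /=.
  by rewrite /word_val big_nil mul1g.
by rewrite word_val_push IHw mulgA /word_val big_cons.
Qed.
HB.instance Definition _ :=
  isMultiplicative.Build free_group G fg_lift fg_lift_is_multiplicative.

Lemma fg_lift_gen t : fg_lift (fg_gen t) = f t.
Proof. by rewrite /fg_lift /word_val /= big_seq1. Qed.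

Lemma fg_lift_unique (psi : {multiplicative free_group -> G}) :
  (forall t, psi (fg_gen t) = f t) -> psi =1 fg_lift.
Proof.
move=> psiE.
have psi1 : psi 1 = 1 by apply: (mulgI (psi 1)); rewrite -gmulfM !mulg1.
case=> s; elim: s => [|x s IHs] rs.
  rewrite /fg_lift /word_val big_nil -psi1; congr (psi _); exact: val_inj.
have rs' : reduced s by apply: path_sorted rs.
pose gx : free_group := exist _ [:: x] isT.
have -> : exist _ (x :: s) rs = gx * exist _ s rs' :> free_group.
  apply: val_inj => /=; case: s rs {IHs rs'} => //= y s.
  by case/andP=> /negPf->.
rewrite gmulfM fg_lift_is_multiplicative IHs; congr (_ * _).
rewrite /fg_lift /word_val /= big_seq1 /letter_val {}/gx.
case: x {rs IHs} => t [] /=; last by rewrite -psiE; congr (psi _); apply: val_inj.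
apply: (mulgI (f t)); rewrite mulgV -psi1 -psiE -gmulfM; congr (psi _).
by apply: val_inj; rewrite /= eqxx.
Qed.

End Universal.
End FreeGroup.

Notation FG n := (free_group 'I_n).

Definition zexpg (G : groupType) (x : G) (k : int) : G :=
  match k with Posz a => x ^+ a | Negz a => x ^- a.+1 end.

(* Equality of sets {c_i | i} = {t}. *)
Definition family_eq1 (k : nat) (T : eqType) (c : 'I_k -> T) (t : T) : Prop :=
  codom c =i pred1 t.

Section Forms.
Variables (n m : nat) (phi : FG n * FG m -> FG n * FG m).

Local Notation a i := (fg_gen (i : 'I_n)).
Local Notation b j := (fg_gen (j : 'I_m)).

Definition formI : Prop :=
  exists (u : FG n) (v : FG m) (p q : 'I_n -> int) (r s : 'I_m -> int),
  u <> 1 /\ v <> 1 /\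
  ~ family_eq1 p 0%R /\ ~ family_eq1 q 0%R /\
  ~ family_eq1 r 0%R /\ ~ family_eq1 s 0%R /\
  (forall i, phi (a i, 1) = (zexpg u (p i), zexpg v (q i))) /\
  (forall j, phi (1, b j) = (zexpg u (r j), zexpg v (s j))).

Definition formII : Prop :=
  exists (v : FG m) (z : 'I_m -> FG n) (q : 'I_n -> int) (s : 'I_m -> int),
  v <> 1 /\
  ~ family_eq1 q 0%R /\ ~ family_eq1 s 0%R /\ ~ family_eq1 z 1 /\
  (forall i, phi (a i, 1) = (1, zexpg v (q i))) /\
  (forall j, phi (1, b j) = (z j, zexpg v (s j))).

Definition formIII : Prop :=
  exists (u : FG n) (w : 'I_m -> FG m) (p : 'I_n -> int) (r : 'I_m -> int),
  u <> 1 /\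
  ~ family_eq1 p 0%R /\ ~ family_eq1 r 0%R /\ ~ family_eq1 w 1 /\
  (forall i, phi (a i, 1) = (zexpg u (p i), 1)) /\
  (forall j, phi (1, b j) = (zexpg u (r j), w j)).

Definition formIV : Prop :=
  exists (z : 'I_m -> FG n) (w : 'I_m -> FG m),
  ~ family_eq1 z 1 /\ ~ family_eq1 w 1 /\
  (forall i, phi (a i, 1) = (1, 1)) /\
  (forall j, phi (1, b j) = (z j, w j)).

Definition formV : Prop :=
  exists (v : FG m) (q : 'I_n -> int) (s : 'I_m -> int),
  v <> 1 /\
  ~ family_eq1 q 0%R /\ ~ family_eq1 s 0%R /\
  (forall i, phi (a i, 1) = (1, zexpg v (q i))) /\
  (forall j, phi (1, b j) = (1, zexpg v (s j))).

Definition formVI : Prop :=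
  exists (x : 'I_n -> FG n) (w : 'I_m -> FG m),
  (forall i, phi (a i, 1) = (x i, 1)) /\
  (forall j, phi (1, b j) = (1, w j)).

Definition formVII : Prop :=
  exists (y : 'I_n -> FG m) (z : 'I_m -> FG n),
  (forall i, phi (a i, 1) = (1, y i)) /\
  (forall j, phi (1, b j) = (z j, 1)).

Definition has_form : Prop :=
  formI \/ formII \/ formIII \/ formIV \/ formV \/ formVI \/ formVII.

End Forms.

Definition swap (A B : Type) (x : A * B) : B * A := (x.2, x.1).

(* Main.v *)
(** The heart of the matter is that, in a free group, the centralizer of a
    nontrivial element [x] is contained in a cyclic subgroup. Up to conjugation
    [x] is given by a cyclically reduced word [c]. If [h] commutes with [c] then
    for [N] large the reduced word [p] of [h c^N = c^N h] begins and ends like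
    [c], so that [p c] and [c p] are reduced and [p] and [c] commute as words;
    the words commuting with [c] are the powers of the shortest nonempty one.
    Consequently, two elementwise commuting families that are both nontrivial
    lie in one cyclic subgroup. Applying this to each of the two coordinates of
    the images of the generators gives the list of forms. *)
Require Import Defs.
From HB Require Import structures.
From mathcomp Require Import all_boot ssralg ssrint.
From mathcomp Require Import zify.

Set Implicit Arguments.
Unset Strict Implicit.
Unset Printing Implicit Defensive.

Local Open Scope group_scope.

(** Here [t] is the shortest nonempty prefix of [c] that commutes with [c]. A nonempty [p] commuting
    with [c] begins with [t], and deleting [t] leaves a shorter word that still commutes with
    [c]. *)
Lemma commuting_words (T : eqType) (c : seq T) : c != [::] ->
  exists t, forall p, p ++ c = c ++ p -> exists k, p = flatten (nseq k t).
Proof.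
move=> c0.
pose P d := (0 < d)%N && (take d c ++ c == c ++ take d c).
have exP : exists d, P d.
  by exists (size c); rewrite /P take_size eqxx andbT lt0n size_eq0.
case: (ex_minnP exP) => d /andP[d0 /eqP tc] dmin.
have dc : (d <= size c)%N.
  by apply: dmin; rewrite /P take_size eqxx andbT lt0n size_eq0.
exists (take d c) => p; have [k] := ubnP (size p).
elim: k p => // k IHk p pk pc.
have [->|p0] := eqVneq p [::]; first by exists 0%N.
(* If [p] is no longer than [c], it is itself a prefix of [c] commuting with [c], so minimality of
   [d] applies. *)
have dp : (d <= size p)%N.
  have [pc_le|/ltnW cp] := leqP (size p) (size c); last exact: leq_trans dc cp.
  apply: dmin; rewrite /P lt0n size_eq0 p0 /=.
  suff -> : take (size p) c = p by rewrite pc.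
  by rewrite -(takel_cat p pc_le) -pc take_size_cat.
have tp : take d p = take d c by rewrite -(takel_cat c dp) pc takel_cat.
have pE : p = take d c ++ drop d p by rewrite -tp cat_take_drop.
have [||j jE] := IHk (drop d p).
- by rewrite size_drop; lia.
- have := congr1 (drop d) pc.
  rewrite {1 2}pE -catA [c ++ _ ++ _]catA -tc -catA !drop_size_cat ?size_takel //.
by exists j.+1; rewrite /= -jE.
Qed.

(** * Cancellation in products and centralizers in a free group *)

Section Centralizers.
Variable T : choiceType.

Implicit Types (x y : T * bool) (w s : seq (T * bool)) (c g h : free_group T).

Local Notation word := (word_val (@fg_gen T)).

Lemma word_cat w s : word (w ++ s) = word w * word s.
Proof. by rewrite /word_val big_cat. Qed.

Lemma word_flatten_nseq k w : word (flatten (nseq k w)) = word w ^+ k.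
Proof.
elim: k => [|k IHk]; first by rewrite /word_val big_nil.
by rewrite /= word_cat IHk expgS.
Qed.

Lemma word_valK g : word (val g) = g.
Proof. exact/esym/(@fg_lift_unique T _ (@fg_gen T) idfun). Qed.

Lemma reduced_cat x0 w s : w != [::] -> s != [::] ->
  reduced (w ++ s) =
  [&& reduced w, reduced s & head x0 s != linv (last x0 w)].
Proof.
case: w s => [|x w] [|y s] //= _ _.
by rewrite /reduced /= cat_path /= [X in _ && X]andbC.
Qed.

Lemma val_mul_cat g h : reduced (val g ++ val h) ->
  val (g * h) = val g ++ val h.
Proof.
move=> /act_nil <-; rewrite [RHS]foldr_cat -[foldr _ _ (val h)]/(act _ _).
by rewrite act_nil //; apply: valP.
Qed.

Lemma size_push x s : ((size s).-1 <= size (push x s))%N.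
Proof. by case: s => //= y s; case: ifP => //= _; lia. Qed.

Lemma last_push x0 x s : (1 < size s)%N -> last x0 (push x s) = last x0 s.
Proof. by case: s => [|y [|z s]] //= _; case: ifP. Qed.

(** Each letter of [w] cancels at most one letter at the front of [s], so a longer [s] keeps its
    end. *)
Lemma last_act x0 w s : (size w < size s)%N ->
  (size s - size w <= size (act w s))%N /\ last x0 (act w s) = last x0 s.
Proof.
elim: w => [|x w IHw] /= ws; first by rewrite subn0.
have [|sz <-] := IHw; first exact: ltnW.
by have := size_push x (act w s); split; [lia | rewrite last_push //; lia].
Qed.

Lemma last_winv x0 s : s != [::] -> last x0 (winv s) = linv (head x0 s).
Proof. by case: s => // x s _; rewrite /winv /= rev_cons last_rcons. Qed.

(* The dual of [last_act], obtained by inverting. *)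
Lemma head_mul x0 g h : (size (val g) < size (val h))%N ->
  head x0 (val (h * g)) = head x0 (val h).
Proof.
move=> gh.
have h0 : val h != [::] by case: (val h) gh.
have size_winv s : size (winv s) = size s by rewrite size_rev size_map.
have [|sz] := @last_act x0 (winv (val g)) (winv (val h)).
  by rewrite !size_winv.
have actE : act (winv (val g)) (winv (val h)) = winv (val (h * g)).
  by rewrite -[LHS]/(val (g^-1 * h^-1)) -invgM.
move: sz; rewrite actE !size_winv => sz.
rewrite !last_winv //; first exact: (can_inj (@linvK T)).
by case: (val (h * g)) sz => //; rewrite leqn0 subn_eq0 leqNgt gh.
Qed.

(** No cancellation occurs between consecutive copies of [c], since [c c] is reduced as a word. *)
Lemma val_cyclically_reduced_exp x0 c k :
    val c != [::] -> reduced (val c ++ val c) ->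
  [/\ (k < size (val (c ^+ k.+1)))%N,
      head x0 (val (c ^+ k.+1)) = head x0 (val c) &
      last x0 (val (c ^+ k.+1)) = last x0 (val c)].
Proof.
move=> c0 cc; elim: k => [|k [sz hd lst]].
  by rewrite expg1 lt0n size_eq0.
have ck0 : val (c ^+ k.+1) != [::] by apply: contraTneq sz => ->.
have := cc; rewrite (reduced_cat x0) // => /and3P[_ _ hl].
rewrite expgS val_mul_cat; last first.
  by rewrite (reduced_cat x0) // hd hl (valP c) (valP (c ^+ k.+1)).
rewrite size_cat last_cat; case: (val c) (val (c ^+ k.+1)) c0 ck0 sz lst => //.
by move=> x s [|y s'] //= _ _ sz ->; split=> //; lia.
Qed.

Lemma zexpg_of_div (G : groupType) (u : G) (a b : nat) :
  exists k, u ^+ a / u ^+ b = zexpg u k.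
Proof.
have [ba|/ltnW ab] := leqP b a.
  by exists (Posz (a - b)); rewrite /= expgnFr.
have -> : u ^+ a / u ^+ b = u ^- (b - a) by rewrite expgnFr // invgF.
by case: (b - a)%N => [|k]; [exists (Posz 0); rewrite /= expg0 invg1 | exists (Negz k)].
Qed.

Lemma centralizer_cyclically_reduced c :
    val c != [::] -> reduced (val c ++ val c) ->
  exists u, forall h, commute h c -> exists k, h = zexpg u k.
Proof.
move=> c0 cc; have [t tP] := commuting_words c0.
(* With this [N] the word of [c ^+ N] is longer than that of [h], so neither product with [h] can
   consume it. *)
exists (word t) => h hc; set N := (size (val h)).+1.
have x0 : T * bool by case: (val c) c0.
have [sz hd lst] := val_cyclically_reduced_exp x0 (size (val h)) c0 cc.
have hcN : commute h (c ^+ N) by apply: commuteX.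
pose p := h * c ^+ N.
have pc : commute p c by apply/commute_sym/commuteM; [|apply: commuteX].
have [szp lstp] : (size (val (c ^+ N)) - size (val h) <= size (val p))%N /\
  last x0 (val p) = last x0 (val (c ^+ N)) by apply: last_act.
have hdp : head x0 (val p) = head x0 (val (c ^+ N)).
  by rewrite /p hcN head_mul.
have p0 : val p != [::].
  by apply: contraTneq szp => ->; rewrite leqn0 subn_eq0 -ltnNge.
have := cc; rewrite (reduced_cat x0) // => /and3P[_ _ hl].
(* [p] starts and ends like [c], so both junctions are reduced and the group identity [pc] is an
   equality of words. *)
have [k pE] : exists k, val p = flatten (nseq k t).
  apply: tP; rewrite -val_mul_cat; last first.
    by rewrite (reduced_cat x0) // lstp lst hl (valP c) (valP p).
  rewrite pc val_mul_cat //.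
  by rewrite (reduced_cat x0) // hdp hd hl (valP c) (valP p).
(* [c] commutes with itself, hence is also a power of [t]; then so is [h], the quotient of [p] by
   [c ^+ N]. *)
have [l cE] := tP _ (erefl (val c ++ val c)).
have -> : h = word t ^+ k / word t ^+ (l * N).
  rewrite expgnA -(word_flatten_nseq k) -(word_flatten_nseq l) -pE -cE.
  by rewrite !word_valK /p mulgK.
exact: zexpg_of_div.
Qed.

Lemma zexpg_conj (G : groupType) (u v : G) k :
  zexpg u k ^ v = zexpg (u ^ v) k.
Proof. by case: k => k /=; rewrite ?conjVg conjXg. Qed.

Lemma commute_zexpg (G : groupType) (u : G) k l :
  commute (zexpg u k) (zexpg u l).
Proof.
have uu a b : commute (u ^+ a) (u ^+ b) by apply/commuteX2/commute_refl.
case: k l => [a|a] [b|b] /=; rewrite ?[commute _ _]uu //.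
- exact/commuteV.
- exact/commute_sym/commuteV.
- exact/commuteV/commute_sym/commuteV.
Qed.

(** Induction on length: if [g] is not cyclically reduced, it is a conjugate of a shorter element,
    and conjugation carries centralizers to centralizers. *)
Lemma centralizer_cyclic g : g <> 1 ->
  exists u, forall h, commute h g -> exists k, h = zexpg u k.
Proof.
have [n] := ubnP (size (val g)); elim: n g => // n IHn g gn g1.
have g0 : val g != [::].
  by apply/eqP=> g0; apply: g1; apply: val_inj.
have [cc|ncc] := boolP (reduced (val g ++ val g)).
  exact: centralizer_cyclically_reduced.
have [x [s gE]] : exists x s, val g = x :: rcons s (linv x).
  move: ncc (valP g) g0; case: (val g) => // x s ncc rs g0.
  move: ncc; rewrite (reduced_cat x) // rs /= negbK => /eqP xl.
  case/lastP: s rs xl {g0} => [|s y] _ /=.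
    (* A single letter is never its own inverse. *)
    by case: x => a [].
  by rewrite last_rcons => ->; exists (linv y), s; rewrite linvK.
have rs : reduced s.
  have := valP g; rewrite gE /reduced /= -cats1 cat_path => /andP[] /=.
  by move=> /path_sorted.
pose h : free_group T := exist _ s rs; pose a := word [:: x].
have aE : word [:: linv x] = a^-1.
  rewrite /a /word_val !big_seq1 /letter_val /=.
  by case: (x.2) => /=; rewrite ?invgK.
have gh : g = h ^ a^-1.
  rewrite -[g]word_valK gE -cats1 -cat1s !word_cat aE -/a conjgE invgK.
  by rewrite (word_valK h).
have [||u uP] := IHn h.
- by move: gn; rewrite gE /= size_rcons; lia.
- by move=> h1; apply: g1; rewrite gh h1 conj1g.
exists (u ^ a^-1) => k kg.
have [|l lE] := uP (k ^ a).
  by rewrite -[h](conjgKV a) -gh /commute -!conjMg kg.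
by exists l; rewrite -zexpg_conj -lE conjgK.
Qed.

End Centralizers.

(** * Commuting families and the list of forms *)

Lemma family_nontrivial (k : nat) (T : eqType) (f : 'I_k -> T) t i :
  f i <> t -> ~ family_eq1 f t.
Proof. by move=> fi /(_ (f i)); rewrite codom_f inE => /esym/eqP. Qed.

Variant commuting_families_spec (k l : nat) (T : choiceType)
    (x : 'I_k -> free_group T) (z : 'I_l -> free_group T) : Prop :=
  | BothTrivial of (forall i, x i = 1) & (forall j, z j = 1)
  | LeftTrivial of (forall i, x i = 1) & ~ family_eq1 z 1
  | RightTrivial of ~ family_eq1 x 1 & (forall j, z j = 1)
  | BothCyclic u p r of u <> 1 & ~ family_eq1 p 0%R & ~ family_eq1 r 0%R
      & (forall i, x i = zexpg u (p i)) & (forall j, z j = zexpg u (r j)).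

Lemma commuting_families (k l : nat) (T : choiceType)
    (x : 'I_k -> free_group T) (z : 'I_l -> free_group T) :
  (forall i j, commute (x i) (z j)) -> commuting_families_spec x z.
Proof.
move=> xz.
have dec q (f : 'I_q -> free_group T) :
    (forall i, f i = 1) \/ exists i, f i <> 1.
  have [/forallP f1|/forallPn[i /eqP fi]] := boolP [forall i, f i == 1].
    by left=> i; apply/eqP.
  by right; exists i.
have [x1|[i xi]] := dec _ x; have [z1|[j zj]] := dec _ z.
- exact: BothTrivial.
- exact/LeftTrivial/(family_nontrivial zj).
- exact/RightTrivial/z1/(family_nontrivial xi).
have [u uP] := centralizer_cyclic xi; have [v vP] := centralizer_cyclic zj.
have /fin_all_exists[r rE] j' : exists e, z j' = zexpg u e.
  exact/uP/commute_sym/xz.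
(* All [x i'] commute with the nontrivial [z j], so they are powers of one [v] and commute with
   [x i]; thus the same [u] serves both families. *)
have /fin_all_exists[p pE] i' : exists e, x i' = zexpg u e.
  apply: uP; have [a ->] := vP _ (xz i' j); have [b ->] := vP _ (xz i j).
  exact: commute_zexpg.
have nontriv q (f : 'I_q -> int) i' : zexpg u (f i') <> 1 -> ~ family_eq1 f 0%R.
  by move=> fi; apply: (@family_nontrivial _ _ _ _ i') => fi0; apply: fi; rewrite fi0.
apply: (BothCyclic (u := u) _ _ _ pE rE).
- move=> u1; apply: xi; rewrite pE u1.
  by case: (p i) => e /=; rewrite expg1n ?invg1.
- by apply: (nontriv _ _ i); rewrite -pE.
- by apply: (nontriv _ _ j); rewrite -rE.
Qed.

Theorem mainTheorem1 (n m : nat) (hn : (2 <= n)%N) (hm : (2 <= m)%N)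
    (phi : {multiplicative (FG n * FG m)%type -> (FG n * FG m)%type}) :
  has_form phi \/ has_form (@swap (FG n) (FG m) \o phi \o @swap (FG m) (FG n)).
Proof.
pose x i := (phi (fg_gen i, 1)).1; pose y i := (phi (fg_gen i, 1)).2.
pose z j := (phi (1, fg_gen j)).1; pose w j := (phi (1, fg_gen j)).2.
have aE i : phi (fg_gen i, 1) = (x i, y i) by rewrite /x /y; case: (phi _).
have bE j : phi (1, fg_gen j) = (z j, w j) by rewrite /z /w; case: (phi _).
(* Generators of different factors commute, hence so do their images, coordinate by coordinate. *)
have comm i j : commute (x i, y i) (z j, w j).
  rewrite -aE -bE; apply: gmulf_commute.
  by rewrite /commute; congr (_, _); rewrite /= ?mulg1 ?mul1g.
have xz : commuting_families_spec x z.
  apply: commuting_families => i j; exact: (gmulf_commute fst (comm i j)).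
have yw : commuting_families_spec y w.
  apply: commuting_families => i j; exact: (gmulf_commute snd (comm i j)).
clearbody x y z w.
(* Sixteen cases. Trivial [y] and [z] give (VI), trivial [x] and [w] give (VII), and four cyclic
   families give (I). The others give (II) to (V), directly or, in four cases, after exchanging the
   factors. *)
case: xz => [x1 z1|x1 z1|x1 z1|u p r u1 p1 r1 xE zE];
case: yw => [y1 w1|y1 w1|y1 w1|v q s v1 q1 s1 yE wE].
- left; do 5 right; left; exists x, w.
  by split=> ?; rewrite ?aE ?bE ?y1 ?z1.
- left; do 5 right; left; exists x, w.
  by split=> ?; rewrite ?aE ?bE ?y1 ?z1.
- left; do 6 right; exists y, z.
  by split=> ?; rewrite ?aE ?bE ?x1 ?w1.
- left; do 4 right; left; exists v, q, s.
  by do 3!split=> //; split=> ?; rewrite ?aE ?bE ?x1 ?z1 ?yE ?wE.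
- left; do 6 right; exists y, z.
  by split=> ?; rewrite ?aE ?bE ?x1 ?w1.
- left; do 3 right; left; exists z, w.
  by do 2!split=> //; split=> ?; rewrite ?aE ?bE ?x1 ?y1.
- left; do 6 right; exists y, z.
  by split=> ?; rewrite ?aE ?bE ?x1 ?w1.
- left; right; left; exists v, z, q, s.
  by do 4!split=> //; split=> ?; rewrite ?aE ?bE ?x1 ?yE ?wE.
- left; do 5 right; left; exists x, w.
  by split=> ?; rewrite ?aE ?bE ?y1 ?z1.
- left; do 5 right; left; exists x, w.
  by split=> ?; rewrite ?aE ?bE ?y1 ?z1.
- right; do 3 right; left; exists y, x.
  by do 2!split=> //; split=> ?; rewrite /swap /= ?aE ?bE ?w1 ?z1.
- right; do 2 right; left; exists v, x, s, q.
  by do 4!split=> //; split=> ?; rewrite /swap /= ?aE ?bE /= ?z1 ?yE ?wE.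
- right; do 4 right; left; exists u, r, p.
  by do 3!split=> //; split=> ?; rewrite /swap /= ?aE ?bE /= ?y1 ?w1 ?xE ?zE.
- left; do 2 right; left; exists u, w, p, r.
  by do 4!split=> //; split=> ?; rewrite ?aE ?bE ?y1 ?xE ?zE.
- right; right; left; exists u, y, r, p.
  by do 4!split=> //; split=> ?; rewrite /swap /= ?aE ?bE /= ?w1 ?xE ?zE.
- left; left; exists u, v, p, q, r, s.
  by do 6!split=> //; split=> ?; rewrite ?aE ?bE ?xE ?zE ?yE ?wE.
Qed.
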